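(* The Hochschild homology $HH_0(A)=A/[A,A]$ has a $\mathbf{k}$-basis consisting of the classes of the following elements: (i) $\zeta_0=1$; (ii) $\alpha_0(n)=x^n$; (iii) $\beta_0(n)=y^n$; (iv) $\gamma_0(n)=z^n$; (v) $\overline\epsilon_0(n_{1,p};m_{1,p})=\overline{xy^{n_1}z^{m_1}xy^{n_2}z^{m_2}\cdots xy^{n_p}z^{m_p}}$, where $n,p,n_1,\dots,n_p,m_1,\dots,m_p$ range over positive integers, and the bar means that the sequence of pairs $(n_1,m_1),\dots,(n_p,m_p)$ is taken up to cyclic permutation (cyclically permuted sequences give the same basis element).
   Context: $\mathbf{k}$ is a field of characteristic $0$, $A=\mathbf{k}\langle x,y,z\rangle/(x^2+yx,\,xz,\,zy)$, $A^e=A\otimes A^{\mathrm{op}}$, and $HH_n(A)=\mathrm{Tor}_n^{A^e}(A,A)$; in particular $HH_0(A)\cong A/[A,A]$, where $[A,A]$ is the linear span of commutators. The notation $n_{1,p}$ stands for the sequence $n_1,\dots,n_p$. *)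

(* Defs.v *)
From HB Require Import structures.
From mathcomp Require Import all_boot all_order all_algebra.
From mathcomp Require Import boolp classical_sets.
From mathcomp Require Import finmap monalg.

Set Implicit Arguments.
Unset Strict Implicit.
Unset Printing Implicit Defensive.

Import GRing.Theory.

Local Open Scope ring_scope.
Local Open Scope classical_set_scope.
Local Open Scope quotient_scope.

Section Span.
Variables (k : fieldType) (V : lmodType k) (S : set V).

Definition lspan : pred V := fun v =>
  `[< exists2 s : seq (k * V), (forall cu, cu \in s -> S cu.2)
        & v = \sum_(cu <- s) cu.1 *: cu.2 >].

Lemma lspanP v :
  reflect (exists2 s : seq (k * V), (forall cu, cu \in s -> S cu.2)
             & v = \sum_(cu <- s) cu.1 *: cu.2) (v \in lspan).
Proof. exact: asboolP. Qed.

Lemma mem_lspan v : S v -> v \in lspan.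
Proof.
move=> Sv; apply/lspanP; exists [:: (1, v)]; last by rewrite big_seq1 scale1r.
by move=> cu; rewrite inE => /eqP->.
Qed.

Lemma lspan0 : 0 \in lspan.
Proof. by apply/lspanP; exists [::]; rewrite ?big_nil. Qed.

Lemma lspanD : {in lspan &, forall u v, u + v \in lspan}.
Proof.
move=> _ _ /lspanP[s Ss ->] /lspanP[t St ->]; apply/lspanP.
exists (s ++ t); last by rewrite big_cat.
by move=> cu; rewrite mem_cat => /orP[/Ss|/St].
Qed.

Lemma lspanZ c : {in lspan, forall v, c *: v \in lspan}.
Proof.
move=> _ /lspanP[s Ss ->]; apply/lspanP.
exists [seq (c * cu.1, cu.2) | cu <- s].
  by move=> _ /mapP[cu /Ss Scu ->].
by rewrite big_map scaler_sumr; apply: eq_bigr => cu _; rewrite scalerA.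
Qed.

Lemma lspan_zmod_closed : zmod_closed lspan.
Proof.
split=> [|u v u_in v_in]; first exact: lspan0.
by rewrite lspanD // -scaleN1r lspanZ.
Qed.

HB.instance Definition _ := GRing.isZmodClosed.Build V lspan lspan_zmod_closed.

Definition lquot := Quotient.quot (GRing.ZmodClosed.clone V lspan _).

HB.instance Definition _ := GRing.Zmodule.on lquot.
HB.instance Definition _ := EqQuotient.on lquot.
HB.instance Definition _ := ZmodQuotient.on lquot.

Lemma lquotE u v : (\pi_lquot u == \pi_lquot v) = (u - v \in lspan).
Proof. by rewrite -Quotient.idealrBE. Qed.

Lemma lquotK (u : lquot) : \pi_lquot (repr u) = u.
Proof. exact: reprK. Qed.

Definition lquot_scale (c : k) (u : lquot) : lquot := \pi_lquot (c *: repr u).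

Lemma pi_lquotZ c v : \pi_lquot (c *: v) = lquot_scale c (\pi_lquot v).
Proof.
apply/eqP; rewrite lquotE -scalerBr; apply: lspanZ.
by rewrite -lquotE reprK.
Qed.

Fact lquot_scalerA c d u :
  lquot_scale c (lquot_scale d u) = lquot_scale (c * d) u.
Proof. by rewrite -[u]lquotK -!pi_lquotZ scalerA. Qed.

Fact lquot_scale1r : left_id 1 lquot_scale.
Proof. by move=> u; rewrite -[u]lquotK -!pi_lquotZ scale1r. Qed.

Fact lquot_scalerDr : right_distributive lquot_scale +%R.
Proof.
move=> c u v; rewrite -[u]lquotK -[v]lquotK -raddfD -!pi_lquotZ scalerDr.
by rewrite raddfD.
Qed.

Fact lquot_scalerDl u : {morph lquot_scale^~ u : c d / c + d}.
Proof. by move=> c d; rewrite -[u]lquotK -!pi_lquotZ scalerDl raddfD. Qed.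

HB.instance Definition _ := GRing.Zmodule_isLmodule.Build k lquot
  lquot_scalerA lquot_scale1r lquot_scalerDr lquot_scalerDl.

Lemma pi_lquot_scalable : scalable \pi_lquot.
Proof. by move=> c v; rewrite pi_lquotZ. Qed.

End Span.

Definition lin_indep (k : fieldType) (V : lmodType k) (I : choiceType)
    (b : I -> V) : Prop :=
  forall (s : seq I) (c : I -> k), uniq s ->
    \sum_(i <- s) c i *: b i = 0 -> forall i, i \in s -> c i = 0.

Definition is_basis (k : fieldType) (V : lmodType k) (I : choiceType)
    (b : I -> V) : Prop :=
  lin_indep b /\ (forall v, v \in lspan (range b)).

(* the linear span of this set is the two-sided ideal (rels) *)
Definition ideal_span (k : fieldType) (F : algType k) (rels : set F) : set F :=
  [set v | exists a r b, rels r /\ v = a * r * b].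

Definition commutators (k : fieldType) (A : algType k) : set A :=
  [set v | exists a b, v = a * b - b * a].

(* HH_0(A), as the quotient vector space A / [A, A] *)
Definition HH0 (k : fieldType) (A : algType k) := lquot (@commutators k A).

HB.instance Definition _ (k : fieldType) (A : algType k) :=
  GRing.Lmodule.on (HH0 A).

Definition HH0_class (k : fieldType) (A : algType k) (a : A) : HH0 A :=
  \pi_(lquot (@commutators k A)) a.

Section FreeAlgebra.
Variable k : fieldType.

(* k<x, y, z>: the algebra of the free monoid on three letters *)
Definition free3 := {malg k[{fmonom 'I_3}]}.

HB.instance Definition _ := GRing.Lalgebra.on free3.

Fact free3_scalerAr (c : k) (u v : free3) : c *: (u * v) = u * (c *: v).
Proof.
rewrite malgZ_def; apply/malgP => m; rewrite -malgZ_def mcoeffZ.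
rewrite (mcoeffMlw m (fsubset_refl _) (fsubset_refl _)).
rewrite (mcoeffMlw m (fsubset_refl (msupp u)) (msuppZ_le c v)) mulr_sumr.
apply: eq_bigr => m1 _; rewrite mulr_sumr; apply: eq_bigr => m2 _.
by rewrite mcoeffZ mulrnAr mulrCA.
Qed.

HB.instance Definition _ := GRing.Lalgebra_isAlgebra.Build k free3
  free3_scalerAr.

End FreeAlgebra.

(* The generators are locked because unifying two distinct ones would
   otherwise unfold the monoid algebra. *)
HB.lock Definition fgen (k : fieldType) (i : 'I_3) : free3 k := << fmu i >>.
Canonical fgen_unlockable := Unlockable fgen.unlock.

Section AlgebraA.
Variable k : fieldType.

Local Notation free3 := (free3 k).

Definition fx : free3 := fgen k (@Ordinal 3 0 isT).
Definition fy : free3 := fgen k (@Ordinal 3 1 isT).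
Definition fz : free3 := fgen k (@Ordinal 3 2 isT).

Definition relsA : set free3 :=
  [set r | [\/ r = fx ^+ 2 + fy * fx, r = fx * fz | r = fz * fy]].

Local Notation J := (lspan (ideal_span relsA)).

Lemma J_mull (a u : free3) : u \in J -> a * u \in J.
Proof.
move=> /lspanP[s Ss ->]; rewrite mulr_sumr big_seq rpred_sum // => cu /Ss.
case=> p [r [q [rr ->]]]; rewrite -scalerAr lspanZ // mem_lspan //.
by exists (a * p), r, q; rewrite !mulrA.
Qed.

Lemma J_mulr (a u : free3) : u \in J -> u * a \in J.
Proof.
move=> /lspanP[s Ss ->]; rewrite mulr_suml big_seq rpred_sum // => cu /Ss.
case=> p [r [q [rr ->]]]; rewrite -scalerAl lspanZ // mem_lspan //.
by exists p, r, (q * a); rewrite !mulrA.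
Qed.

Lemma J1 : 1 \notin J.
Proof.
apply/negP => /lspanP[s Ss /(congr1 (mcoeff mone))].
rewrite mcoeff1 eqxx raddf_sum /= big_seq big1 => [/eqP|cu /Ss].
  by rewrite oner_eq0.
have gen0 i : (fgen k i)@_mone = 0.
  by rewrite unlock mcoeffU1 fmP fm1 fmuE.
have D0 (u v : free3) : (u + v)@_mone = u@_mone + v@_mone by exact: mcoeffD.
have M0 (u v : free3) : (u * v)@_mone = u@_mone * v@_mone.
  by have [mM _] := mcoeff1g_is_multiplicative {fmonom 'I_3} k; exact: mM.
case=> p [r [q [rr ->]]]; rewrite mcoeffZ !M0.
suff -> : r@_mone = 0 by rewrite mulr0 mul0r mulr0.
have [x0 y0 z0] : [/\ (fx : free3)@_mone = 0, fy@_mone = 0 & fz@_mone = 0].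
  by split; exact: gen0.
case: rr => ->; last 2 first.
- by rewrite M0 x0 mul0r.
- by rewrite M0 z0 mul0r.
have -> : fx ^+ 2 = fx * fx := erefl.
by rewrite (D0 (fx * fx)) (M0 fx fx) (M0 fy fx) x0 mulr0 mulr0 addr0.
Qed.

(* A = k<x, y, z> / (x^2 + yx, xz, zy) *)
Definition algA := lquot (ideal_span relsA).

HB.instance Definition _ := GRing.Lmodule.on algA.
HB.instance Definition _ := ZmodQuotient.on algA.

Definition piA (u : free3) : algA := \pi_algA u.

Definition mulA (u v : algA) : algA := piA (repr u * repr v).

Lemma piAM (u v : free3) : piA (u * v) = mulA (piA u) (piA v).
Proof.
apply/eqP; rewrite lquotE.
set u' := repr _; set v' := repr _.
have -> : u * v - u' * v' = (u - u') * v + u' * (v - v').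
  by rewrite mulrBl mulrBr addrA addrNK.
rewrite rpredD //; [apply: J_mulr | apply: J_mull];
  by rewrite -lquotE reprK.
Qed.

Lemma reprA (u : algA) : piA (repr u) = u.
Proof. exact: reprK. Qed.

Lemma piAD (u v : free3) : piA (u + v) = piA u + piA v.
Proof. exact: raddfD. Qed.

Lemma piAZ (c : k) (u : free3) : piA (c *: u) = c *: piA u.
Proof. exact: pi_lquotZ. Qed.

Fact mulA_assoc : associative mulA.
Proof.
by move=> u v w; rewrite -[u]reprA -[v]reprA -[w]reprA -!piAM mulrA.
Qed.

Fact mul1A : left_id (piA 1) mulA.
Proof. by move=> u; rewrite -[u]reprA -piAM mul1r. Qed.

Fact mulA1 : right_id (piA 1) mulA.
Proof. by move=> u; rewrite -[u]reprA -piAM mulr1. Qed.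

Fact mulADl : left_distributive mulA +%R.
Proof.
move=> u v w; rewrite -[u]reprA -[v]reprA -[w]reprA.
by rewrite -piAD -!piAM mulrDl piAD.
Qed.

Fact mulADr : right_distributive mulA +%R.
Proof.
move=> u v w; rewrite -[u]reprA -[v]reprA -[w]reprA.
by rewrite -piAD -!piAM mulrDr piAD.
Qed.

Fact oneA_neq0 : piA 1 != 0.
Proof.
have -> : 0 = piA 0 by rewrite /piA raddf0.
by rewrite lquotE subr0 J1.
Qed.

HB.instance Definition _ := GRing.Zmodule_isNzRing.Build algA
  mulA_assoc mul1A mulA1 mulADl mulADr oneA_neq0.

Fact scalerAlA (c : k) (u v : algA) : c *: (u * v) = (c *: u) * v.
Proof.
rewrite -[u]reprA -[v]reprA -piAZ.
by rewrite -[_ * _]piAM -[RHS]piAM -piAZ scalerAl.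
Qed.

HB.instance Definition _ := GRing.Lmodule_isLalgebra.Build k algA scalerAlA.

Fact scalerArA (c : k) (u v : algA) : c *: (u * v) = u * (c *: v).
Proof.
rewrite -[u]reprA -[v]reprA -piAZ.
by rewrite -[_ * _]piAM -[RHS]piAM -piAZ scalerAr.
Qed.

HB.instance Definition _ := GRing.Lalgebra_isAlgebra.Build k algA scalerArA.

Fact piA_monoid_morphism : monoid_morphism piA.
Proof. by split; [exact: erefl | exact: piAM]. Qed.

Fact piA_zmod_morphism : zmod_morphism piA.
Proof. exact: raddfB. Qed.

HB.instance Definition _ := GRing.isZmodMorphism.Build free3 algA piA
  piA_zmod_morphism.
HB.instance Definition _ := GRing.isMonoidMorphism.Build free3 algA piA
  piA_monoid_morphism.
HB.instance Definition _ := GRing.isScalable.Build k free3 algA *:%R piA piAZ.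

Definition Ax : algA := piA fx.
Definition Ay : algA := piA fy.
Definition Az : algA := piA fz.

End AlgebraA.

Definition posn := {n : nat | (0 < n)%N}.

(* nonempty sequences (n_1, m_1), ..., (n_p, m_p) of pairs of positive
   integers *)
Definition pairseq :=
  {s : seq (nat * nat) |
     (s != [::]) && all (fun nm => (0 < nm.1) && (0 < nm.2))%N s}.

Definition cyc_eq : rel pairseq :=
  fun s t => `[< exists i, val t = rot i (val s) >].

Fact cyc_eq_equiv : equiv_class_of cyc_eq.
Proof.
split=> [s|s t|s t u]; first by apply/asboolP; exists 0%N; rewrite rot0.
- suff sym a b : cyc_eq a b -> cyc_eq b a by apply/idP/idP; apply: sym.
  case/asboolP=> i eqb; apply/asboolP; exists (size (val a) - i)%N.
  by rewrite eqb -[LHS](rotK i) /rotr size_rot.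
- move=> /asboolP[i eqs] /asboolP[j equ]; apply/asboolP.
  eexists; rewrite equ eqs [in LHS]rot_minn [rot i _]rot_minn.
  by rewrite rot_add_mod // ?size_rot geq_minr.
Qed.

Canonical cyc_eq_equivRel := EquivRelPack cyc_eq_equiv.
Definition cycseq := {eq_quot cyc_eq}.

HB.instance Definition _ := EqQuotient.on cycseq.
HB.instance Definition _ := Choice.on cycseq.

Inductive basis_index : Type :=
| Zeta0
| Alpha0 of posn
| Beta0 of posn
| Gamma0 of posn
| Epsilon0 of cycseq.

HB.instance Definition _ := gen_eqMixin basis_index.
HB.instance Definition _ := gen_choiceMixin basis_index.

Section Elements.
Variable k : fieldType.

Definition eps_word (s : pairseq) : algA k :=
  \prod_(nm <- val s) (Ax k * Ay k ^+ nm.1 * Az k ^+ nm.2).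

Definition basis_elt (i : basis_index) : algA k :=
  match i with
  | Zeta0 => 1
  | Alpha0 n => Ax k ^+ val n
  | Beta0 n => Ay k ^+ val n
  | Gamma0 n => Az k ^+ val n
  | Epsilon0 c => eps_word (repr c)
  end.

End Elements.

(* Main.v *)
(* Up to rotation a word in x, y, z represents an element of HH_0(A). If it
   contains no z, each y that is cyclically followed by an x becomes -x, so it
   reduces to a power of y or to a signed power of x. If it contains a z, then a
   cyclic factor xx, yx, xz or zy makes its class zero, because z a x x = 0 in A
   for every word a. The remaining words are the powers of z and the rotations
   of the words x y^n1 z^m1 ... x y^np z^mp. Independence follows from one
   linear functional on the free algebra for each basis element. The functional
   reads off the coefficient of that element from a word, and it vanishes on
   the commutators and on the ideal of relations. *)
Require Import Defs.
From HB Require Import structures.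
From mathcomp Require Import all_boot all_order all_algebra.
From mathcomp Require Import boolp classical_sets.
From mathcomp Require Import finmap monalg.

Set Implicit Arguments.
Unset Strict Implicit.
Unset Printing Implicit Defensive.

Import GRing.Theory.
Local Open Scope ring_scope.

(** * Induction on linear spans, the three letters and the forbidden pairs *)

Lemma lspan_ind (k : fieldType) (V : lmodType k) (S : set V) (P : V -> Prop) :
  P 0 -> (forall c v w, S v -> P w -> P (c *: v + w)) ->
  forall v, v \in lspan S -> P v.
Proof.
move=> P0 PD v /lspanP[s Ss ->].
elim: s Ss => [|cu s IHs] Ss; first by rewrite big_nil.
rewrite big_cons; apply: PD; first by apply: Ss; rewrite inE eqxx.
by apply: IHs => cv cv_s; apply: Ss; rewrite inE cv_s orbT.
Qed.

Definition lX : 'I_3 := @Ordinal 3 0 isT.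
Definition lY : 'I_3 := @Ordinal 3 1 isT.
Definition lZ : 'I_3 := @Ordinal 3 2 isT.

Lemma letterP (u : 'I_3) : [\/ u = lX, u = lY | u = lZ].
Proof.
by case: u => [[|[|[|//]]] ?]; [apply: Or31 | apply: Or32 | apply: Or33];
  apply: val_inj.
Qed.

(** Both monomials of x^2 + yx are excluded, not only a leading one: in a cyclic word that contains
    z, each of them makes the class vanish. *)
Definition adj : rel 'I_3 := fun u v =>
  (u, v) \notin [:: (lX, lX); (lY, lX); (lX, lZ); (lZ, lY)].

Lemma nadjP u v : ~~ adj u v ->
  [\/ (u, v) = (lX, lX), (u, v) = (lY, lX), (u, v) = (lX, lZ)
    | (u, v) = (lZ, lY)].
Proof.
rewrite negbK !inE.
by case/or4P => /eqP ->; [apply: Or41|apply: Or42|apply: Or43|apply: Or44].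
Qed.

(** * Sequences over an arbitrary alphabet *)

Section Words.
Variable T : eqType.
Implicit Types (e : rel T) (p w : seq T).

Lemma not_path_split e x p : ~~ path e x p ->
  exists p1 u v p2, x :: p = p1 ++ u :: v :: p2 /\ ~~ e u v.
Proof.
elim: p x => [//|y p IHp] x /=; case: (boolP (e x y)) => [_ /IHp|nexy _].
  by case=> p1 [u [v [p2 [-> nuv]]]]; exists (x :: p1), u, v, p2.
by exists [::], x, y, p.
Qed.

(** The bad pair can be the closing one, from the last letter back to the first; a rotation then
    brings it to the front. In a one-letter word that pair is the letter with itself, hence the
    separate alternative. *)
Lemma not_cycle_rot e w : ~~ cycle e w ->
  (exists u, w = [:: u] /\ ~~ e u u)
  \/ exists i u v w', rot i w = u :: v :: w' /\ ~~ e u v.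
Proof.
case: w => [//|c w] /= /not_path_split[p1 [u [v [p2 [eqw nuv]]]]].
case/lastP: p2 eqw => [|p2 d].
  rewrite -cat_rcons cats1 -rcons_cons => /rcons_inj[eqw cv]; subst v.
  case: p1 eqw => [[cu ->]|b p1 [cb ->]]; subst c.
    by left; exists u.
  right; exists (size (b :: p1)), u, b, p1.
  by rewrite -cats1 -cat_cons rot_size_cat.
rewrite -rcons_cons -2!rcons_cons -rcons_cat => /rcons_inj[eqw _].
by right; exists (size p1), u, v, (p2 ++ p1); rewrite eqw rot_size_cat.
Qed.

Lemma nseq_cat_inj (a : T) n m p w :
  ohead p != Some a -> ohead w != Some a ->
  nseq n a ++ p = nseq m a ++ w -> n = m /\ p = w.
Proof.
move=> pa wa; elim: n m => [|n IHn] [|m] //=.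
- by move=> eqp; rewrite eqp eqxx in pa.
- by move=> eqp; rewrite -eqp eqxx in wa.
- by case=> /IHn[-> ->].
Qed.

Lemma prefix_avoid (x : T) p w u v : x \notin p ->
  p ++ w = u ++ x :: v -> exists u', u = p ++ u' /\ w = u' ++ x :: v.
Proof.
elim: p u => [|a p IHp] u /=; first by exists u.
rewrite inE negb_or => /andP[xa xp]; case: u => [|b u] /=.
  by case=> ax; rewrite ax eqxx in xa.
by case=> -> /(IHp _ xp)[u' [-> ->]]; exists u'.
Qed.

End Words.

(** * Words made of blocks x y^n z^m *)

Definition block (nm : nat * nat) : seq 'I_3 :=
  lX :: nseq nm.1 lY ++ nseq nm.2 lZ.

Definition blocks (s : seq (nat * nat)) : seq 'I_3 := flatten (map block s).

Definition pos_pairs : pred (seq (nat * nat)) :=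
  all (fun nm => (0 < nm.1) && (0 < nm.2))%N.

Lemma blocks_cat s t : blocks (s ++ t) = blocks s ++ blocks t.
Proof. by rewrite /blocks map_cat flatten_cat. Qed.

Lemma ohead_blocks s : ohead (blocks s) = if s is [::] then None else Some lX.
Proof. by case: s => [|[n m] s]. Qed.

(** The exponents are lengths of maximal runs: positivity of the second exponent ends the run of y
    at a z, and the run of z ends at the next x or at the end of the word. *)
Lemma blocks_inj s t : pos_pairs s -> pos_pairs t -> blocks s = blocks t ->
  s = t.
Proof.
elim: s t => [|[n m] s IHs] [|[n' m'] t] //= /andP[/andP[_ m_gt0] pos_s].
move=> /andP[/andP[_ m'_gt0] pos_t] /eqP.
rewrite /blocks /= -!/(blocks _) => /eqP[]; rewrite -!catA => eqb.
case: m m_gt0 eqb => // m _; case: m' m'_gt0 => // m' _ eqb.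
have [||-> eqz] // := nseq_cat_inj _ _ eqb.
have head_blocks r : ohead (blocks r) != Some lZ.
  by rewrite ohead_blocks; case: r.
have [-> eqr] := nseq_cat_inj (head_blocks s) (head_blocks t) eqz.
by rewrite (IHs t).
Qed.

(** The letter x occurs only at the start of a block, so a cut just before an x separates two
    blocks. *)
Lemma blocks_split s u v : blocks s = u ++ lX :: v ->
  exists s1 s2, [/\ s = s1 ++ s2, u = blocks s1 & lX :: v = blocks s2].
Proof.
elim: s u => [|[n m] s IHs] [|a u] //.
  by move=> eqs; exists [::], ((n, m) :: s); rewrite eqs.
rewrite /blocks /= -!/(blocks _) => -[<- eqs].
have nX : lX \notin nseq n lY ++ nseq m lZ.
  by rewrite mem_cat !mem_nseq !andbF.
have [u' [-> /IHs[s1 [s2 [-> -> ->]]]]] := prefix_avoid nX eqs.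
by exists ((n, m) :: s1), s2.
Qed.

(** This is a three-state automaton whose state is the last letter read. Its transitions are x to y,
    y to y or z, z to z or x, so the three claims feed one another in the induction. The final [lX]
    closes the cycle at the initial x. *)
Lemma path_adj_blocks w :
  [/\ path adj lX (rcons w lX) ->
        exists s, [/\ s != [::], pos_pairs s & lX :: w = blocks s],
      path adj lY (rcons w lX) ->
        exists n m s, [/\ (0 < m)%N, pos_pairs s
          & w = nseq n lY ++ nseq m lZ ++ blocks s] &
      path adj lZ (rcons w lX) ->
        exists m s, pos_pairs s /\ w = nseq m lZ ++ blocks s].
Proof.
elim: w => [|a w [IHX IHY IHZ]].
  by split=> // _; exists 0%N, [::].
case: (letterP a) => ->; split => //=.
- by case/IHX => s [s0 pos_s ->]; exists 0%N, s.
- case/IHY => n [m [s [m0 pos_s ->]]]; exists ((n.+1, m) :: s).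
  by split=> //=; rewrite ?m0 // /blocks /= catA.
- by case/IHY => n [m [s [m0 pos_s ->]]]; exists n.+1, m, s.
- by case/IHZ => m [s [pos_s ->]]; exists 0%N, m.+1, s.
- by case/IHZ => m [s [pos_s ->]]; exists m.+1, s.
Qed.

Lemma cycle_adj_blocks s : pos_pairs s -> cycle adj (blocks s).
Proof.
have pathY n p : path adj lY (nseq n lY ++ p) = path adj lY p.
  by elim: n => //= n ->.
have pathZ m p : path adj lZ (nseq m lZ ++ p) = path adj lZ p.
  by elim: m => //= m ->.
have path_blocks r : pos_pairs r -> path adj lZ (rcons (blocks r) lX).
  elim: r => [//|[[//|n] [|m]] r IHr] //= pos_r.
  rewrite /blocks /= -/(blocks _) -catA rcons_cat pathY /=.
  by rewrite rcons_cat pathZ; apply: IHr.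
case: s => [//|nm s] /path_blocks.
by [].
Qed.

(** Only z or x may follow z, so without x the letter z repeats all the way around. *)
Lemma cycle_adj_nseq_lZ w : cycle adj w -> lX \notin w -> lZ \in w ->
  exists2 n, (0 < n)%N & w = nseq n lZ.
Proof.
move=> cyc nX /[dup] z_w /rot_to[i w' eqw].
have : all (pred1 lZ) (rot i w).
  move: cyc nX; rewrite -(rot_cycle i) -(mem_rot i) eqw /= inE /=.
  elim: w' {eqw} => //= a w' IHw; case: (letterP a) => -> //=.
rewrite (eq_all_r (mem_rot i w)) => /all_pred1P eq_w.
exists (size w) => //; by case: (w) z_w.
Qed.

(* The axioms say that the linear extension of h to the free algebra kills the
   commutators and the defining relations of A. *)
Record word_trace (k : fieldType) (V : lmodType k) (h : seq 'I_3 -> V) := {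
  trace_cat : forall u v, h (u ++ v) = h (v ++ u);
  trace_xx : forall w, h [:: lX, lX & w] = - h [:: lY, lX & w];
  trace_xz : forall w, h [:: lX, lZ & w] = 0;
  trace_zy : forall w, h [:: lZ, lY & w] = 0
}.

Definition basis_word (i : basis_index) : seq 'I_3 :=
  match i with
  | Zeta0 => [::]
  | Alpha0 n => nseq (val n) lX
  | Beta0 n => nseq (val n) lY
  | Gamma0 n => nseq (val n) lZ
  | Epsilon0 c => blocks (val (repr c))
  end.

Lemma cyc_eq_repr s : cyc_eq s (repr (\pi_cycseq s)%qT).
Proof. by apply/eqmodP; rewrite reprK. Qed.

(** * Reduction of every word to a basis word under a trace *)

Section Reduction.
Variables (k : fieldType) (V : lmodType k) (h : seq 'I_3 -> V).
Hypothesis h_trace : word_trace h.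

Lemma trace_rot i w : h (rot i w) = h w.
Proof. by rewrite /rot (trace_cat h_trace) cat_take_drop. Qed.

Lemma trace_cat_xx a p : h (a ++ [:: lX, lX & p]) = - h (a ++ [:: lY, lX & p]).
Proof. by rewrite !(trace_cat h_trace a) (trace_xx h_trace). Qed.

Lemma trace_cyc_eq s t : cyc_eq s t ->
  h (blocks (val s)) = h (blocks (val t)).
Proof.
case/asboolP=> i ->.
by rewrite /rot blocks_cat (trace_cat h_trace) -blocks_cat cat_take_drop.
Qed.

(* In A the letter y can be turned into -x when an x follows, so z x x = 0
   propagates to z a x x = 0. *)
Lemma trace_zxx a p : h (lZ :: a ++ [:: lX, lX & p]) = 0.
Proof.
have zxx q : h [:: lZ, lX, lX & q] = 0.
  by rewrite (trace_cat_xx [:: lZ]) (trace_zy h_trace) oppr0.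
elim/last_ind: a p => [|a c IHa] p; first exact: zxx.
rewrite cat_rcons; case: (letterP c) => ->; first exact: IHa.
  by rewrite -cat_cons -[LHS]opprK -trace_cat_xx cat_cons IHa oppr0.
(* The last letter is z: rotating everything before it to the end leaves a word that starts with z x
   x. *)
by rewrite -cat_cons (trace_cat h_trace) zxx.
Qed.

(** The letters of [a] are treated from right to left, so each y is followed by an x when its turn
    comes and becomes -x. The scalar is thus a sign. *)
Lemma trace_no_lZ a p : lZ \notin a ->
  exists c, h (a ++ lX :: p) = c *: h (nseq (size a) lX ++ lX :: p).
Proof.
elim/last_ind: a p => [|a b IHa] p; first by exists 1; rewrite scale1r.
rewrite mem_rcons inE negb_or => /andP[bZ /IHa{}IHa].
have [c eqc] := IHa (lX :: p).
have nseqXS : nseq (size (rcons a b)) lX ++ lX :: p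
            = nseq (size a) lX ++ [:: lX, lX & p].
  by rewrite size_rcons -(addn1 (size a)) nseqD -catA.
rewrite nseqXS cat_rcons; case: (letterP b) bZ => -> // _.
exists (- c); rewrite scaleNr -eqc -[LHS]opprK; congr (- _).
by rewrite -trace_cat_xx.
Qed.

Lemma trace_reduce w : exists c i, h w = c *: h (basis_word i).
Proof.
have zero : h w = 0 -> exists c i, h w = c *: h (basis_word i).
  by move=> ->; exists 0, Zeta0; rewrite scale0r.
case: (boolP (lZ \in w)) => [z_w|z_w]; last first.
  case: (boolP (lX \in w)) => [/rot_to[i w' eqw]|x_w].
    have z_w' : lZ \notin w'.
      by move: z_w; rewrite -(mem_rot i) eqw inE negb_or.
    have [c eqc] := trace_no_lZ [::] z_w'; exists c.
    exists (Alpha0 (exist _ (size w').+1 isT)).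
    (* The leading x goes to the end of the word, so that the conversion can run through all of
       [w']. *)
    rewrite -(trace_rot i) eqw -cat1s (trace_cat h_trace) eqc /=.
    by rewrite (trace_cat h_trace).
  have eqw : w = nseq (size w) lY.
    apply/all_pred1P/allP => u u_w; case: (letterP u) u_w => -> //.
      by move=> x_w'; rewrite x_w' in x_w.
    by move=> z_w'; rewrite z_w' in z_w.
  rewrite eqw; case: (size w) => [|n].
    by exists 1, Zeta0; rewrite scale1r.
  by exists 1, (Beta0 (exist _ n.+1 isT)); rewrite scale1r.
have [|/not_cycle_rot[[u [eqw]]|[i [u [v [w' [eqw]]]]]]] := boolP (cycle adj w).
- case: (boolP (lX \in w)) => [/rot_to[i w' eqw]|x_w] cyc.
    move: cyc; rewrite -(rot_cycle i) eqw.
    have [blocksX _ _] := path_adj_blocks w'.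
    move=> /blocksX[s [s0 pos_s eqs]].
    have Ps : (s != [::]) && pos_pairs s by rewrite s0.
    pose s' : pairseq := exist _ s Ps.
    exists 1, (Epsilon0 (\pi_cycseq s')%qT).
    rewrite scale1r -(trace_rot i) eqw eqs.
    exact: (trace_cyc_eq (cyc_eq_repr s')).
  have [n n_gt0 ->] := cycle_adj_nseq_lZ cyc x_w z_w.
  by exists 1, (Gamma0 (exist _ n n_gt0)); rewrite scale1r.
(* A one-letter word containing z is z itself, and z may follow z. *)
- by move: z_w; rewrite eqw inE => /eqP <-.
move/nadjP => bad; apply: zero.
have z_w' : lZ \in [:: u, v & w'] by rewrite -eqw mem_rot.
rewrite -(trace_rot i) eqw.
(* Rotating a z of [w'] to the front gives a word z q x x p. *)
have zero_xx : lZ \in w' -> h [:: lX, lX & w'] = 0.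
  case/splitPr=> p q; rewrite -2!cat_cons (trace_cat h_trace) cat_cons.
  exact: trace_zxx.
case: bad z_w' => -[-> ->]; rewrite ?inE /= => z_w'.
- exact: zero_xx.
- by apply/oppr_inj; rewrite oppr0 -(trace_xx h_trace) zero_xx.
- exact: trace_xz.
- exact: trace_zy.
Qed.

End Reduction.

(** * Rotations of block words *)

Lemma rot_rot_ex (T : Type) i j (w : seq T) :
  exists l, rot i (rot j w) = rot l w.
Proof.
eexists; rewrite [rot i _]rot_minn [rot j w]rot_minn.
by rewrite rot_add_mod // ?size_rot geq_minr.
Qed.

Lemma mem_blocks s u : s != [::] -> pos_pairs s -> u \in blocks s.
Proof.
case: s => [//|[[//|n] [|m]] s] _ //= _; rewrite mem_cat !inE mem_cat !mem_nseq.
by case: (letterP u) => ->; rewrite ?orbT.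
Qed.

Lemma mem_blocks_pairseq (s : pairseq) u : u \in blocks (val s).
Proof. by have /andP[s0 pos_s] := valP s; apply: mem_blocks. Qed.

(** The rotated word starts with x, so the cut falls between two blocks and the rotation of letters
    comes from a rotation of pairs. *)
Lemma rot_blocks_cyc_eq (s t : pairseq) i :
  rot i (blocks (val t)) = blocks (val s) -> cyc_eq t s.
Proof.
have /andP[t0 pos_t] := valP t; have /andP[s0 pos_s] := valP s.
move=> eqs; apply/asboolP.
have [a [t' eqt]] : exists a t', val s = a :: t'.
  by case: (val s) s0 => // a t'; exists a, t'.
have [t1 [t2 [eqt12 eqt1 eqt2]]] : exists t1 t2, [/\ val t = t1 ++ t2,
    take i (blocks (val t)) = blocks t1 & drop i (blocks (val t)) = blocks t2].
  (* If [i] reaches the length of the word, nothing is left after the cut, which then lies after the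
     last block. *)
  case eqd: (drop i (blocks (val t))) => [|b d].
    exists (val t), [::]; rewrite cats0; split=> //.
    by rewrite -[RHS](cat_take_drop i) eqd cats0.
  have bX : b = lX by move: eqs; rewrite /rot eqd eqt => -[].
  have [|t1 [t2 [eqt12 eqt1 eqt2]]] :=
      @blocks_split (val t) (take i (blocks (val t))) d.
    by rewrite -bX -eqd cat_take_drop.
  by exists t1, t2; rewrite -eqt1 -eqt2 -bX.
exists (size t1); rewrite eqt12 rot_size_cat; apply: blocks_inj => //.
  by move: pos_t; rewrite eqt12 /pos_pairs !all_cat andbC.
by rewrite -eqs /rot eqt1 eqt2 -blocks_cat.
Qed.

Lemma rot_blocks_bad (s : pairseq) u v w : ~~ adj u v ->
  `[< exists j, rot j [:: u, v & w] = blocks (val s) >] = false.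
Proof.
move=> nuv; apply/asboolP => -[j eqs].
have /andP[_ /cycle_adj_blocks] := valP s.
by rewrite -eqs rot_cycle /= (negPf nuv).
Qed.

Lemma rot_nseq_neq_blocks (s : pairseq) n a j :
  rot j (nseq n a) <> blocks (val s).
Proof.
move=> eqs.
have all_a b : b = a.
  have := mem_blocks_pairseq s b.
  by rewrite -eqs mem_rot mem_nseq => /andP[_ /eqP].
by have := all_a lX; rewrite -(all_a lY).
Qed.

Lemma blocks_neq_nseq (s : pairseq) n a : (blocks (val s) == nseq n a) = false.
Proof.
by apply/eqP => eqs; apply: (@rot_nseq_neq_blocks s n a 0); rewrite rot0.
Qed.

(** * Coordinate functionals on words *)

Section Coordinates.
Variable k : fieldType.

(** For [Alpha0] the sign records that every y of a word with an x and no z turns into -x. For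
    [Epsilon0] the value is the indicator of a rotation class. *)
Definition word_coord (i : basis_index) (w : seq 'I_3) : k :=
  match i with
  | Zeta0 => (w == [::])%:R
  | Alpha0 n => if [&& lZ \notin w, lX \in w & size w == val n]
                then (-1) ^+ count_mem lY w else 0
  | Beta0 n => (w == nseq (val n) lY)%:R
  | Gamma0 n => (w == nseq (val n) lZ)%:R
  | Epsilon0 c => `[< exists j, rot j w = blocks (val (repr c)) >]%:R
  end.

Lemma eq_nseq_cat (T : eqType) (u v : seq T) n a :
  (u ++ v == nseq n a) = [&& all (pred1 a) u, all (pred1 a) v
                            & (size u + size v == n)%N].
Proof.
rewrite andbA -all_cat -size_cat.
apply/eqP/andP => [->|[/all_pred1P {2}-> /eqP->//]].
by rewrite size_nseq all_pred1_nseq.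
Qed.

Lemma word_coord_trace i : @word_trace k k^o (word_coord i).
Proof.
case: i => [|n|n|n|c]; split=> [u v|w|w|w] /=; rewrite ?oppr0 //.
- by case: u v => [|a u] [|b v].
- rewrite !mem_cat !size_cat !count_cat addnC (addnC (count _ _)).
  by rewrite [X in ~~ X]orbC [X in _ && (X && _)]orbC.
(* Passing from xx to yx adds one y, which flips the sign, and preserves the three tests. *)
- rewrite !inE /=; case: ifP => _; last by rewrite oppr0.
  by rewrite add0n exprS mulN1r opprK.
- by rewrite !eq_nseq_cat addnC andbCA.
- by case: (val n) => [|[|m]]; rewrite ?oppr0 //= !eqseq_cons.
- by case: (val n) => [|[|m]].
- by case: (val n) => [|[|m]].
- by rewrite !eq_nseq_cat addnC andbCA.
- by case: (val n) => [|[|m]]; rewrite ?oppr0.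
- by case: (val n) => [|[|m]].
- by case: (val n) => [|[|m]].
- congr (_%:R); congr nat_of_bool; apply/asbool_equiv_eq.
  suff rot_catC (a b : seq 'I_3) B :
    (exists j, rot j (a ++ b) = B) -> exists j, rot j (b ++ a) = B
    by split; apply: rot_catC.
  case=> j <-; rewrite -(rot_size_cat b a).
  have [l ->] := rot_rot_ex j (size b) (b ++ a).
  by exists l.
- by rewrite !rot_blocks_bad ?oppr0.
- by rewrite rot_blocks_bad.
- by rewrite rot_blocks_bad.
Qed.

Lemma word_coord_self i : word_coord i (basis_word i) = 1.
Proof.
case: i => [|[[//|n] ?]|n|n|c] /=; rewrite ?eqxx //.
  by rewrite -[_ :: _]/(nseq n.+1 lX) mem_nseq size_nseq count_nseq inE !eqxx.
by rewrite asboolT //; exists 0; rewrite rot0.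
Qed.

(** Equality on [basis_index] is classical and does not compute on constructors, so the diagonal
    case is expressed by a propositional equality. *)
Lemma word_coord_other i j : word_coord i (basis_word j) = 0 \/ i = j.
Proof.
have nseq0 (n : posn) (a : 'I_3) : (nseq (val n) a == [::]) = false.
  by case: n => -[].
have nseqE (n m : posn) (a b : 'I_3) :
    (nseq (val m) b == nseq (val n) a) = (n == m) && (a == b).
  apply/eqP/andP => [eqs|[/eqP-> /eqP->] //].
  have eq_nm : val n = val m by rewrite -(size_nseq (val n) a) -eqs size_nseq.
  split; first exact/eqP/val_inj.
  case: n m eqs {eq_nm} => [[//|n] ?] [[//|m] ?] [eqs _]; exact/eqP.
have blocks_nseq (c : cycseq) n a :
    `[< exists l, rot l (nseq n a) = blocks (val (repr c)) >] = false.
  by apply/asboolP => -[l]; exact: rot_nseq_neq_blocks.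
case: i => [|n|n|n|c].
- case: j => [|m|m|m|d] /=; rewrite ?nseq0; try by [left | right].
  (* The empty word is read as a power of x with exponent 0. *)
  by left; rewrite (blocks_neq_nseq _ 0 lX).
- case: j => [|m|m|m|d] /=; rewrite ?mem_nseq ?andbF ?mem_blocks_pairseq;
    try by left.
  rewrite size_nseq (val_eqE m n : (sval m == sval n) = _).
  have [->|_] := eqVneq m n; first by right.
  by left; rewrite !andbF.
- case: j => [|m|m|m|d] /=; rewrite ?nseqE ?andbF ?blocks_neq_nseq; try by left.
    by left; rewrite eq_sym nseq0.
  by case: eqP => [->|_]; [right | left].
- case: j => [|m|m|m|d] /=; rewrite ?nseqE ?andbF ?blocks_neq_nseq; try by left.
    by left; rewrite eq_sym nseq0.
  by case: eqP => [->|_]; [right | left].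
- case: j => [|m|m|m|d] /=; rewrite ?blocks_nseq; try by left.
    by left; rewrite (blocks_nseq c 0 lX).
  case: asboolP => [[l /rot_blocks_cyc_eq /eqmodP]|_]; last by left.
  by rewrite !reprK => ->; right.
Qed.

Lemma word_coord_basis i j : word_coord i (basis_word j) = (i == j)%:R.
Proof.
have [->|neq_ij] := eqVneq; first exact: word_coord_self.
by have [->|/eqP] := word_coord_other i j; last rewrite (negPf neq_ij).
Qed.

End Coordinates.

(** * The quotient by commutators, and descent of functionals to it *)

Lemma HH0_class_is_linear (k : fieldType) (A : algType k) :
  linear (@HH0_class k A).
Proof.
by move=> c a b; rewrite /HH0_class [LHS]raddfD; congr (_ + _);
  exact: pi_lquotZ.
Qed.

HB.instance Definition _ (k : fieldType) (A : algType k) :=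
  GRing.isLinear.Build k A (HH0 A) *:%R (@HH0_class k A)
    (@HH0_class_is_linear k A).

Lemma HH0_class_eq0 (k : fieldType) (A : algType k) (a : A) :
  (HH0_class a == 0) = (a \in lspan (@commutators k A)).
Proof. by rewrite -[a in RHS]subr0 -lquotE raddf0. Qed.

Lemma HH0_classMC (k : fieldType) (A : algType k) (a b : A) :
  HH0_class (a * b) = HH0_class (b * a).
Proof. by apply/eqP; rewrite lquotE mem_lspan //; exists a, b. Qed.

(* F stands for the free algebra. It is kept abstract because unification
   would otherwise unfold the monoid algebra. *)
Section HH0Basis.
Variables (k : fieldType) (F A : algType k) (g : 'I_3 -> F).
Variable pi : {lrmorphism F -> A}.

Definition gword (w : seq 'I_3) : F := \prod_(i <- w) g i.

Definition grels : set F :=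
  [set r | [\/ r = g lX ^+ 2 + g lY * g lX, r = g lX * g lZ
             | r = g lZ * g lY]]%classic.

Hypothesis gword_span : forall u, u \in lspan (range gword).
Hypothesis gword_ext : forall h : seq 'I_3 -> k,
  exists f : {linear F -> k^o}, forall w, f (gword w) = h w.
Hypothesis pi_surj : forall a, exists u, pi u = a.
Hypothesis pi_ker : forall u, (pi u == 0) = (u \in lspan (ideal_span grels)).

Lemma gword_cat u v : gword (u ++ v) = gword u * gword v.
Proof. by rewrite /gword big_cat. Qed.

Lemma gword_cons i w : gword (i :: w) = g i * gword w.
Proof. by rewrite /gword big_cons. Qed.

Definition word_class (w : seq 'I_3) : HH0 A := HH0_class (pi (gword w)).

Lemma pi_grels r u : grels r -> pi (r * u) = 0.
Proof.
move=> rr; apply/eqP; rewrite pi_ker mem_lspan //.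
by exists 1, r, u; rewrite mul1r.
Qed.

Lemma word_class_trace : word_trace word_class.
Proof.
split=> [u v|w|w|w]; rewrite /word_class.
- by rewrite !gword_cat !rmorphM HH0_classMC.
- apply/eqP; rewrite -addr_eq0 -linearD -linearD /= !gword_cons !mulrA -mulrDl.
  by rewrite pi_grels ?linear0 //; apply: Or31.
- by rewrite !gword_cons mulrA pi_grels ?linear0 //; apply: Or32.
- by rewrite !gword_cons mulrA pi_grels ?linear0 //; apply: Or33.
Qed.

Section Descent.
Variables (h : seq 'I_3 -> k) (f : {linear F -> k^o}).
Hypothesis h_trace : @word_trace k k^o h.
Hypothesis fE : forall w, f (gword w) = h w.

(** Both sides are bilinear, so it suffices to compare them on words, where this is rotation
    invariance. *)
Lemma ext_mulC u v : f (u * v) = f (v * u).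
Proof.
elim/lspan_ind: u / (gword_span u) => [|c _ u' [a _ <-] IHu].
  by rewrite mul0r mulr0.
rewrite mulrDl mulrDr !linearD IHu -scalerAl -scalerAr !linearZ /=.
congr (_ *: _ + _).
elim/lspan_ind: v / (gword_span v) {IHu} => [|d _ v' [b _ <-] IHv].
  by rewrite mul0r mulr0.
rewrite mulrDl mulrDr !linearD IHv -scalerAl -scalerAr !linearZ /=.
by rewrite -!gword_cat !fE (trace_cat h_trace).
Qed.

Lemma ext_grels r u : grels r -> f (r * u) = 0.
Proof.
move=> rr.
elim/lspan_ind: u / (gword_span u) => [|c _ u' [w _ <-] IHu].
  by rewrite mulr0 linear0.
rewrite mulrDr linearD IHu addr0 -scalerAr linearZ /=.
case: rr => ->.
- rewrite expr2 mulrDl linearD -!mulrA -!gword_cons !fE.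
  by rewrite (trace_xx h_trace) addNr scaler0.
- by rewrite -mulrA -!gword_cons fE (trace_xz h_trace) scaler0.
- by rewrite -mulrA -!gword_cons fE (trace_zy h_trace) scaler0.
Qed.

(** Under [f] a product a r b can be replaced by r (b a). This is why [word_trace] states the
    relations only at the front of a word. *)
Lemma ext_ker u : pi u = 0 -> f u = 0.
Proof.
move/eqP; rewrite pi_ker.
elim/lspan_ind: u / => [|c _ w [a [r [b [rr ->]]]] IHw].
  exact: linear0.
rewrite linearD IHw addr0 linearZ /= -mulrA ext_mulC -mulrA ext_grels //.
exact: scaler0.
Qed.

(** A combination of commutators in [A] lifts to one in [F], on which [f] vanishes; the lift differs
    from [u] by an element of the kernel of [pi]. *)
Lemma ext_HH0_eq0 u : HH0_class (pi u) = 0 -> f u = 0.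
Proof.
move/eqP; rewrite HH0_class_eq0 => u_comm.
suff [v uv v0] : exists2 v, pi v = pi u & f v = 0.
  by rewrite -[u](subrK v) linearD v0 addr0 ext_ker // linearB /= uv subrr.
elim/lspan_ind: (pi u) / u_comm => [|c _ w [a [b ->]] [v <- v0]].
  by exists 0; rewrite linear0.
have [[a' <-] [b' <-]] := (pi_surj a, pi_surj b).
exists (c *: (a' * b' - b' * a') + v).
  by rewrite linearD linearZ linearB /= !rmorphM.
by rewrite linearD v0 addr0 linearZ linearB /= ext_mulC subrr scaler0.
Qed.

End Descent.

Lemma word_class_basis : is_basis (fun i => word_class (basis_word i)).
Proof.
split=> [s c uniq_s sum0 i i_s|v].
  have [f fE] := gword_ext (word_coord k i).
  (* The vanishing combination is lifted to [F], where the functional of index [i] extracts the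
     coefficient [c i]. *)
  have : HH0_class (pi (\sum_(j <- s) c j *: gword (basis_word j))) = 0.
    rewrite -[RHS]sum0 !linear_sum; apply: eq_bigr => j _.
    by rewrite !linearZ.
  move/(ext_HH0_eq0 (word_coord_trace k i) fE).
  rewrite linear_sum (bigD1_seq i) //= big1 => [|j neq_ji].
    by rewrite addr0 linearZ fE word_coord_self => <-; exact/esym/mulr1.
  by rewrite linearZ fE word_coord_basis eq_sym (negPf neq_ji); exact: mulr0.
have -> : v = HH0_class (repr v) by rewrite /HH0_class reprK.
have [u <-] := pi_surj (repr v).
elim/lspan_ind: u / (gword_span u) => [|c _ u [w _ <-] IHu].
  by rewrite !linear0 lspan0.
rewrite !linearP; apply: lspanD IHu; apply: lspanZ.
have [d [i]] := trace_reduce word_class_trace w.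
rewrite [in LHS]/word_class /= => ->; apply/lspanZ/mem_lspan.
by exists i.
Qed.

End HH0Basis.

(** * The free algebra as the span of its words *)

Section FreeWords.
Variable k : fieldType.

Lemma gword_fgen w : gword (fgen k) w = << FMonom w >>.
Proof.
elim: w => [|i w IHw].
  rewrite /gword big_nil; congr << _ >>.
  by apply/eqP; rewrite fmP fm1.
rewrite gword_cons IHw unlock malgM_def fgmulUU mulr1; congr << _ >>.
by apply/eqP; rewrite fmP fmM fmuE.
Qed.

Lemma gword_fgen_span u : u \in lspan (range (gword (fgen k))).
Proof.
apply/lspanP; exists [seq (u@_m, gword (fgen k) m) | m <- msupp u].
  by move=> _ /mapP[m _ ->]; exists (m : seq 'I_3).
rewrite big_map [LHS]monalgE; apply: eq_bigr => m _.
rewrite gword_fgen fmK; apply/malgP=> n.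
by rewrite [RHS]mcoeffZ !mcoeffU mulrnAr mulr1.
Qed.

(** With [idfun] on coefficients, [mmap] is linear extension from the basis of monomials. *)
Definition word_ext (h : seq 'I_3 -> k) (u : free3 k) : k^o :=
  mmap idfun (fun m : {fmonom 'I_3} => h m) u.

Lemma word_ext_is_linear h : linear (word_ext h).
Proof.
move=> c u v; rewrite /word_ext [LHS]mmapD; congr (_ + _).
rewrite (mmapEw (msuppZ_le c u)) mmapE scaler_sumr.
by apply: eq_bigr => m _; rewrite mcoeffZ -mulrA.
Qed.

HB.instance Definition _ h := GRing.isLinear.Build k (free3 k) k^o *:%R
  (word_ext h) (word_ext_is_linear h).

Lemma word_ext_gword h w : word_ext h (gword (fgen k) w) = h w.
Proof. by rewrite gword_fgen /word_ext mmapU mul1r. Qed.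

Lemma piA_eq0 (u : free3 k) :
  (piA u == 0) = (u \in lspan (ideal_span (grels (fgen k)))).
Proof. by rewrite -[u in RHS]subr0 -lquotE [X in _ = (_ == X)]raddf0. Qed.

Lemma piA_nseq n i : piA (gword (fgen k) (nseq n i)) = piA (fgen k i) ^+ n.
Proof. by rewrite /gword big_nseq -rmorphXn /= -Monoid.iteropE. Qed.

Lemma piA_blocks s : piA (gword (fgen k) (blocks s)) =
  \prod_(nm <- s) (Ax k * Ay k ^+ nm.1 * Az k ^+ nm.2).
Proof.
elim: s => [|nm s IHs]; first by rewrite /gword !big_nil rmorph1.
rewrite big_cons -IHs /blocks /= gword_cons !gword_cat !rmorphM /= !piA_nseq.
by rewrite !mulrA.
Qed.

Lemma basis_eltE i : basis_elt k i = piA (gword (fgen k) (basis_word i)).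
Proof.
case: i => [|n|n|n|c] /=; rewrite ?piA_nseq ?piA_blocks //.
by rewrite /gword big_nil rmorph1.
Qed.

End FreeWords.

Theorem proposition3p2 (k : fieldType) (char0 : [pchar k] =i pred0) :
  (forall s t : pairseq, cyc_eq s t ->
     HH0_class (eps_word k s) = HH0_class (eps_word k t))
  /\ is_basis (fun i : basis_index => HH0_class (basis_elt k i)).
Proof.
have pi_surj (a : algA k) : exists u, piA u = a.
  by exists (repr a); exact: reprA.
split=> [s t st|].
  (* Independence of the chosen representative is the rotation invariance of the trace
     [word_class]. *)
  rewrite /eps_word -!piA_blocks.
  exact: trace_cyc_eq (word_class_trace (@piA_eq0 k)) _ _ st.
under [X in is_basis X]funext => i do rewrite basis_eltE.
apply: word_class_basis => //.
- exact: gword_fgen_span.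
- by move=> h; exists (word_ext h); exact: word_ext_gword.
- exact: piA_eq0.
Qed.
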